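(* The binomial distribution family has the hierarchical low-rank property. That is, for every $\epsilon>0$ there exists a positive integer $S_\epsilon$, with $S_\epsilon=O(\mathrm{polylog}(1/\epsilon))$, such that for every integer $n\ge 1$, every integer $\ell\ge 1$ and every $k\in\{0,1,\ldots,2^\ell-1\}$, there exist real-valued functions $\alpha_i(p)$ and $\beta_i(q)$, $1\le i\le S_\epsilon$ (which may depend on $\epsilon,n,\ell,k$), such that for all $(p,q)\in B_{\ell,k}$ with $p\in\{0,\tfrac1n,\tfrac2n,\ldots,1\}$ and $q\in[0,1]$ $$\binom{n}{np}q^{np}(1-q)^{n-np}=\sum_{i=1}^{S_\epsilon}\alpha_i(p)\beta_i(q)+O(\epsilon).$$
   Context: The function $f(p,q)=\binom{n}{np}q^{np}(1-q)^{n-np}$ is the probability that a binomial random variable with $n$ trials and success parameter $q\in[0,1]$ equals $np$ (convention $0^0=1$). For each integer $\ell\ge 1$ and $k\in\{0,1,\ldots,2^\ell-1\}$, the block $B_{\ell,k}\subset[0,1]^2$ (first coordinate $p$, second coordinate $q$) is $$B_{\ell,k}=\begin{cases}[k/2^\ell,(k+1)/2^\ell]\times[(k+1)/2^\ell,(k+2)/2^\ell], & k\text{ even},\\ [k/2^\ell,(k+1)/2^\ell]\times[(k-1)/2^\ell,k/2^\ell], & k\text{ odd}.\end{cases}$$ Asymptotic notation: $S_\epsilon=O(\mathrm{polylog}(1/\epsilon))$ means that there are absolute constants $A,m>0$ with $S_\epsilon\le A(\ln(1/\epsilon))^m$ for all $0<\epsilon\le 1/2$. The error term $O(\epsilon)$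 denotes a quantity of absolute value at most $C\epsilon$, with $C$ an absolute constant independent of $\epsilon,n,\ell,k,p,q$. *)

(* Defs.v *)
From mathcomp Require Import all_boot all_order all_algebra.
From mathcomp Require Import all_classical all_reals all_analysis.

Set Implicit Arguments.
Unset Strict Implicit.
Unset Printing Implicit Defensive.

Import Order.TTheory GRing.Theory Num.Theory.
Local Open Scope classical_set_scope.
Local Open Scope ring_scope.

(* First coordinate p, second coordinate q; for odd k the subtraction k - 1
   is the one of R. *)
Definition block (R : realType) (l k : nat) : set (R * R) :=
  if odd k then
    `[k%:R / 2 ^+ l, (k%:R + 1) / 2 ^+ l] `*`
    `[(k%:R - 1) / 2 ^+ l, k%:R / 2 ^+ l]
  else
    `[k%:R / 2 ^+ l, (k%:R + 1) / 2 ^+ l] `*`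
    `[(k%:R + 1) / 2 ^+ l, (k%:R + 2) / 2 ^+ l].

Arguments block : clear implicits.

(* S eps = O(polylog (1 / eps)), uniformly over 0 < eps <= 1/2, where
   ln (1 / eps) >= ln 2 > 0. *)
Definition polylog_bounded (R : realType) (S : R -> nat) : Prop :=
  exists A m : R, [/\ 0 < A, 0 < m &
    forall eps : R, 0 < eps <= 1 / 2 ->
      (S eps)%:R <= A * ln (1 / eps) `^ m].

(* Main.v *)
Require Import Defs.
From mathcomp Require Import all_boot all_order all_algebra.
From mathcomp Require Import all_classical all_reals all_analysis.
From mathcomp Require Import ring lra.
Import Order.TTheory GRing.Theory Num.Theory.
Import numFieldNormedType.Exports.
Local Open Scope classical_set_scope.
Local Open Scope ring_scope.

(** Let [c] be the corner at which the block touches the diagonal. Tilting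
    the success parameter from [c] to [q] writes the pmf at [j] as
    [A j * B q * expR (- z)], where [A] is the pmf at parameter [c],
    [B = expR (- n * KL (c || q))], and [z >= 0] is [j - n * c] times the
    difference of the log-odds of [c] and [q]. All three factors are at most 1,
    so [A] and [B] may be replaced by 0 where they are below [eps]. Where both
    are at least [eps], Chernoff-type bounds, valid because the block is no
    wider than its distance to the boundary, give
    [z <= 13 * ln (1 / eps)], uniformly in [n]. There the Taylor polynomial of
    [expR (- z)] of degree [O (ln (1 / eps))] is accurate to [eps], and each
    of its monomials is a product of a function of [j] and a function of [q]. *)

(** * Taylor remainders of [expR (- z)] for [z >= 0] *)

Lemma is_derive_expRN_taylor (R : realType) (m : nat) (y : R) :
  is_derive y 1
    (fun t : R => expR (- t) - \sum_(i < m.+1) (- t) ^+ i / i`!%:R)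
    (- (expR (- y) - \sum_(i < m) (- y) ^+ i / i`!%:R)).
Proof.
have dN : is_derive y (1 : R) (fun t : R => - t) (- 1).
  exact: is_deriveNid.
have dterm (i : 'I_m.+1) : is_derive y (1 : R)
    (fun t : R => (- t) ^+ i / i`!%:R)
    (- (if i : nat is k.+1 then (- y) ^+ k / k`!%:R else 0)).
  have -> : (fun t : R => (- t) ^+ i / i`!%:R) =
      i`!%:R^-1 \*: (fun t : R => - t) ^+ i.
    by apply/funext => t; rewrite /= exprfctE mulrC.
  apply: is_derive_eq.
  case: i => -[|k] ik /=; first by rewrite mul0r scale0r scaler0 oppr0.
  rewrite factS natrM invfM /GRing.scale/=.
  have k0 : k`!%:R != 0 :> R by rewrite pnatr_eq0 -lt0n fact_gt0.
  by field; rewrite k0 /= addrC natr1 pnatr_eq0.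
have dexp : is_derive y (1 : R) (fun t => expR (- t)) (- expR (- y)).
  have := @is_derive1_comp R expR (fun t => - t) y _ _ (is_derive_expR _) dN.
  by rewrite mulrN1.
have -> : (fun t : R => expR (- t) - \sum_(i < m.+1) (- t) ^+ i / i`!%:R) =
    (fun t => expR (- t)) -
    \sum_(i < m.+1) (fun t : R => (- t) ^+ i / i`!%:R).
  by apply/funext => t; rewrite /= fct_sumE.
apply: is_derive_eq; rewrite big_ord_recl /= oppr0 add0r.
by rewrite sumrN -opprD.
Qed.

(** Induction on [m]: the remainder of order [m.+1] vanishes at 0 and its derivative is minus the
    remainder of order [m], so by the mean value theorem the sign alternates. *)
Lemma expRN_taylor_sign (R : realType) (m : nat) (z : R) : 0 <= z ->
  0 <= (-1) ^+ m * (expR (- z) - \sum_(i < m) (- z) ^+ i / i`!%:R).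
Proof.
elim: m z => [|m IH] z z0; first by rewrite big_ord0 subr0 expr0 mul1r expR_ge0.
pose F k (y : R) := expR (- y) - \sum_(i < k) (- y) ^+ i / i`!%:R.
have dF (y : R) : is_derive y (1 : R) (F m.+1) (- F m y).
  exact: is_derive_expRN_taylor.
have cF : {within `[0, z], continuous (F m.+1)}.
  apply: derivable_within_continuous => y _.
  by apply: ex_derive.
have [c /[!in_itv]/= /andP[c0 _]] := MVT_segment z0 (fun y _ => dF y) cF.
have -> : F m.+1 0 = 0.
  rewrite /F big_ord_recl big1 => [|i _]; last by rewrite oppr0 expr0n mul0r.
  by rewrite oppr0 expR0 expr0 fact0 divr1 addr0 subrr.
rewrite !subr0 => e; rewrite -/(F m.+1 z) e exprS mulN1r mulrA mulrNN.
by rewrite mulr_ge0//; exact: IH.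
Qed.

(** Consecutive remainders have opposite signs and differ by the term of degree [m], whose absolute
    value therefore bounds the first of them. *)
Lemma expRN_taylor_le (R : realType) (m : nat) (z : R) : 0 <= z ->
  `|expR (- z) - \sum_(i < m) (- z) ^+ i / i`!%:R| <= z ^+ m / m`!%:R.
Proof.
move=> z0; have := expRN_taylor_sign R m.+1 z z0.
have := expRN_taylor_sign R m z z0.
rewrite big_ord_recr/= opprD addrA; set d := expR _ - _ => d0.
have -> : `|d| = (-1) ^+ m * d.
  by rewrite -[RHS]ger0_norm// normrM normrX normrN1 expr1n mul1r.
rewrite exprS mulN1r [(- z) ^+ m]exprNn mulNr oppr_ge0 mulrBr subr_le0.
by rewrite !mulrA -exprMn mulrNN mulr1 expr1n mul1r.
Qed.

Lemma expRN_ge_cubic (R : realType) (a : R) : 0 <= a ->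
  1 - a + a ^+ 2 / 2 - a ^+ 3 / 6 <= expR (- a).
Proof.
move=> a0; have := expRN_taylor_sign R 4 a a0.
rewrite !big_ord_recr big_ord0 /= !factS fact0; lra.
Qed.

Lemma exprn_fact_le_expR (R : realType) (m : nat) (r : R) : 0 <= r ->
  r ^+ m / m`!%:R <= expR r.
Proof.
case: m => [|m] r0; first by rewrite expr0 fact0 divr1 -expR0 ler_expR.
by apply: le_trans (expR_ge1Dxn m r0); rewrite lerDr.
Qed.

Lemma expRN_taylor_small (R : realType) (m : nat) (K L z : R) :
  0 <= z -> z <= K * L -> (K * expR 1 + 1) * L <= m%:R ->
  `|expR (- z) - \sum_(i < m) (- z) ^+ i / i`!%:R| <= expR (- L).
Proof.
move=> z0 zL mL; apply: le_trans (expRN_taylor_le _ _ _ z0) _.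
have e0 : 0 <= expR 1 * z by rewrite mulr_ge0 ?expR_ge0.
(* With [e = expR 1], pulling out [expR (- m)] leaves a term of the series of [expR (e z)], so the
   error is at most [expR (e z - m)]. *)
have -> : z ^+ m / m`!%:R =
    expR (- m%:R) * ((expR 1 * z) ^+ m / m`!%:R).
  rewrite exprMn -expRM_natl mulr1 !mulrA -expRD addNr expR0.
  by rewrite mul1r.
apply: le_trans (ler_wpM2l (expR_ge0 _) (exprn_fact_le_expR _ _ _ e0)) _.
rewrite -expRD ler_expR.
have := ler_wpM2l (expR_ge0 1) zL.
lra.
Qed.

(** * Tilting and large deviations of the binomial pmf *)

Lemma binomial_pmf_le1 (R : realType) (n j : nat) (q : R) :
  0 <= q <= 1 -> binomial_pmf n q j <= 1.
Proof.
move=> /andP[q0 q1].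
have [jn|nj] := leqP j n; last by rewrite /binomial_pmf bin_small// mulr0n ler01.
have -> : 1 = \sum_(i < n.+1) binomial_pmf n q i.
  rewrite -[LHS](expr1n _ n) -[X in X ^+ n](subrK q) exprDn.
  by apply: eq_bigr => i _; rewrite /binomial_pmf mulrC.
rewrite (bigD1 (Ordinal (jn : (j < n.+1)%N)))//= lerDl.
by apply: sumr_ge0 => i _; rewrite binomial_pmf_ge0// q0.
Qed.

Lemma binomial_pmf_onem (R : realType) (n j : nat) (q : R) : (j <= n)%N ->
  binomial_pmf n (1 - q) (n - j) = binomial_pmf n q j.
Proof.
move=> jn; rewrite /binomial_pmf bin_sub// subKn//.
by rewrite /unstable.onem subKr mulrC.
Qed.

Lemma binomial_pmf_tilt (R : realType) (n j : nat) (c q : R) : (j <= n)%N ->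
  0 < c < 1 -> 0 < q < 1 ->
  binomial_pmf n q j = binomial_pmf n c j *
    expR (j%:R * ln (q / c) + (n%:R - j%:R) * ln ((1 - q) / (1 - c))).
Proof.
move=> jn /andP[c0 c1] /andP[q0 q1].
have c1' : 0 < 1 - c by rewrite subr_gt0.
have q1' : 0 < 1 - q by rewrite subr_gt0.
rewrite expRD -natrB// !expRM_natl !lnK ?posrE ?divr_gt0//.
rewrite /binomial_pmf /unstable.onem mulrnAl; congr (_ *+ _).
rewrite mulrACA -!exprMn; congr (_ ^+ _ * _ ^+ _).
  by rewrite mulrCA divff ?mulr1 ?gt_eqF.
by rewrite mulrCA divff ?mulr1 ?gt_eqF.
Qed.

Lemma ln_ge_subV (R : realType) (z : R) : 0 < z -> 1 - z^-1 <= ln z.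
Proof.
move=> z0; have := @le_ln1Dx R (z^-1 - 1).
rewrite subrKC lnV ?posrE// => h.
have : -1 < z^-1 - 1 by rewrite ltrBrDl subrr invr_gt0.
by move=> /h; lra.
Qed.

(* Obtained by tilting [c] to [c + x / 4], where the pmf is still at most 1. *)
Lemma binomial_pmf_chernoff (R : realType) (n j : nat) (c x u v : R) :
  (j <= n)%N -> 0 < c < 1 -> 0 <= x -> 0 <= v <= 1 -> 0 <= u <= 1 ->
  x = c * v -> x = (1 - c) * u -> j%:R = n%:R * (c + x) ->
  binomial_pmf n c j <= expR (- (n%:R * x * (v + u) / 8)).
Proof.
move=> jn c01 x0 /andP[v0 v1] /andP[u0 u1] xv xu jE.
have /andP[c0 c1] := c01.
have c1' : 0 < 1 - c by rewrite subr_gt0.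
pose q := c + x / 4.
have q01 : 0 < q < 1 by rewrite /q; apply/andP; split; nra.
have hv : v / 4 - v ^+ 2 / 16 <= ln (q / c).
  have -> : q / c = 1 + v / 4.
    by rewrite /q xv; field; rewrite gt_eqF.
  apply: le_trans (ln_ge_subV _ _ _); last by lra.
  rewrite -subr_ge0.
  have -> : 1 - (1 + v / 4)^-1 - (v / 4 - v ^+ 2 / 16) =
     (v / 4) ^+ 3 / (1 + v / 4) by field; lra.
  by rewrite divr_ge0 ?exprn_ge0//; lra.
have hu : - u / 4 - u ^+ 2 / 8 <= ln ((1 - q) / (1 - c)).
  have -> : (1 - q) / (1 - c) = 1 - u / 4.
    by rewrite /q xu; field; rewrite gt_eqF.
  apply: le_trans (ln_ge_subV _ _ _); last by lra.
  rewrite -subr_ge0.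
  have -> : 1 - (1 - u / 4)^-1 - (- u / 4 - u ^+ 2 / 8) =
     (u ^+ 2 / 16) * (1 - u / 2) / (1 - u / 4) by field; lra.
  by rewrite divr_ge0 ?mulr_ge0 ?exprn_ge0//; nra.
have := @binomial_pmf_le1 R n j q.
rewrite (binomial_pmf_tilt _ _ _ _ _ jn c01 q01) => h.
have {h} := h ltac:(case/andP: q01 => *; lra).
rewrite -ler_pdivlMr ?expR_gt0// mul1r -expRN => h.
apply: le_trans h _; rewrite ler_expR lerN2.
have n0 : 0 <= n%:R :> R by [].
have cx : 0 <= c + x by lra.
have cx' : 0 <= 1 - (c + x) by nra.
rewrite jE.
have h1 := ler_wpM2l cx hv.
have h2 := ler_wpM2l cx' hu.
have -> : n%:R * (c + x) * ln (q / c) +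
    (n%:R - n%:R * (c + x)) * ln ((1 - q) / (1 - c)) =
  n%:R * ((c + x) * ln (q / c) + (1 - (c + x)) * ln ((1 - q) / (1 - c))).
  by ring.
have -> : n%:R * x * (v + u) / 8 = n%:R * (x * (v + u) / 8) by ring.
apply: ler_wpM2l => //.
apply: le_trans (lerD h1 h2).
(* Since [(c + x) v = x (1 + v)] and [(1 - (c + x)) u = x (1 - u)], the leading parts [x / 4] of the
   two logarithmic terms cancel. *)
have -> : (c + x) * (v / 4 - v ^+ 2 / 16) = x * (1 + v) * (1 / 4 - v / 16).
  by rewrite xv; ring.
have -> : (1 - (c + x)) * (- u / 4 - u ^+ 2 / 8) =
   - x * (1 - u) * (1 / 4 + u / 8).
  have -> : 1 - (c + x) = (1 - c) * (1 - u) by rewrite xu; ring.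
  by rewrite [in RHS]xu; ring.
rewrite -subr_ge0.
have -> : x * (1 + v) * (1 / 4 - v / 16) + - x * (1 - u) * (1 / 4 + u / 8) -
  x * (v + u) / 8 = x * (v / 16 * (1 - v) + u ^+ 2 / 8) by field.
by rewrite mulr_ge0// addr_ge0 ?mulr_ge0 ?exprn_ge0//; lra.
Qed.

(** The Chernoff bound forces [n x (x / c + x / (1 - c)) <= 8 L], and each of the two nonnegative
    summands inherits the bound. *)
Lemma binomial_pmf_ge_deviation (R : realType) (n j : nat) (c x L : R) :
  (j <= n)%N -> (0 < n)%N -> 0 < c < 1 -> 0 <= x <= c ->
  j%:R = n%:R * (c + x) -> expR (- L) <= binomial_pmf n c j ->
  n%:R * x ^+ 2 <= 8 * L * c /\ n%:R * x ^+ 2 <= 8 * L * (1 - c).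
Proof.
move=> jn n0 c01 /andP[x0 xc] jE.
have /andP[c0 c1] := c01.
have c1' : 0 < 1 - c by rewrite subr_gt0.
have n0' : 0 < n%:R :> R by rewrite ltr0n.
have x1 : x <= 1 - c.
  have : j%:R <= n%:R :> R by rewrite ler_nat.
  by rewrite jE -ler_pdivlMl// mulVf ?gt_eqF//; lra.
pose v := x / c; pose u := x / (1 - c).
have xv : x = c * v by rewrite /v mulrC divfK ?gt_eqF.
have xu : x = (1 - c) * u by rewrite /u mulrC divfK ?gt_eqF.
have v01 : 0 <= v <= 1 by rewrite /v divr_ge0 ?(ltW c0)//= ler_pdivrMr// mul1r.
have u01 : 0 <= u <= 1 by rewrite /u divr_ge0 ?(ltW c1')//= ler_pdivrMr// mul1r.
move=> /le_trans /(_ (binomial_pmf_chernoff _ _ _ _ _ u v jn c01 x0 v01 u01 xv xu jE)).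
case/andP: v01 => v0 _; case/andP: u01 => u0 _.
rewrite ler_expR lerN2 => h.
have nx : 0 <= n%:R * x by rewrite mulr_ge0.
have hv : n%:R * x * v <= 8 * L by have := mulr_ge0 nx u0; lra.
have hu : n%:R * x * u <= 8 * L by have := mulr_ge0 nx v0; lra.
split.
  have -> : n%:R * x ^+ 2 = n%:R * x * v * c by rewrite expr2 {2}xv; ring.
  by rewrite ler_pM2r.
have -> : n%:R * x ^+ 2 = n%:R * x * u * (1 - c) by rewrite expr2 {2}xu; ring.
by rewrite ler_pM2r.
Qed.

(** * Bounding the tilt exponent *)

(** The square of [n x a] is [n x^2] times [n a^2]; the weight [s], which is [c] or [1 - c] in the
    applications, cancels between the two bounds. *)
Lemma ler_mul_of_sqr_weighted (R : realType) (n x a s L A B M : R) :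
  0 <= n -> 0 <= L -> 0 <= M -> 0 <= A -> A * B <= M ^+ 2 ->
  n * x ^+ 2 <= A * L * s -> n * s * a ^+ 2 <= B * L -> n * x * a <= M * L.
Proof.
move=> n0 L0 M0 A0 ABM hx ha.
have ML : 0 <= M * L by rewrite mulr_ge0.
have [/ltW h|h] := ltP (n * x * a) 0; first exact: le_trans h ML.
rewrite -ler_sqr ?nnegrE//.
have na2 : 0 <= n * a ^+ 2 by rewrite mulr_ge0// sqr_ge0.
have -> : (n * x * a) ^+ 2 = n * x ^+ 2 * (n * a ^+ 2) by ring.
apply: le_trans (ler_wpM2r na2 hx) _.
have -> : A * L * s * (n * a ^+ 2) = A * L * (n * s * a ^+ 2) by ring.
apply: le_trans (ler_wpM2l (mulr_ge0 A0 L0) ha) _.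
have -> : A * L * (B * L) = (A * B) * L ^+ 2 by ring.
by rewrite exprMn ler_wpM2r// sqr_ge0.
Qed.

(* [c * a - (1 - c) * b] is the Kullback-Leibler divergence of the Bernoulli
   laws of parameters [c] and [q], where [q = c * expR (- a)] and
   [1 - q = (1 - c) * expR b]. *)
Lemma tilt_exponent_le (R : realType) (n a b c x L : R) :
  0 <= n -> 0 <= L -> 0 < c < 1 -> 0 <= a -> 0 <= b -> 0 <= x <= c ->
  c * expR (- a) + (1 - c) * expR b = 1 ->
  n * x ^+ 2 <= 8 * L * c -> n * x ^+ 2 <= 8 * L * (1 - c) ->
  n * (c * a - (1 - c) * b) <= L ->
  n * x * (a + b) <= 13 * L.
Proof.
move=> n0 L0 /andP[c0 c1] a0 b0 /andP[x0 xc] ab1 xL xL' kl.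
have c1' : 0 <= 1 - c by lra.
(* Adding [c * expR (- a) + (1 - c) * expR b - 1 = 0] splits the divergence into two nonnegative
   pieces, each of which is then controlled by [L]. *)
have {kl} kl : n * c * (expR (- a) - 1 + a) +
    n * (1 - c) * (expR b - 1 - b) <= L.
  apply: le_trans kl; rewrite le_eqVlt; apply/orP; left; apply/eqP.
  have -> : c * a - (1 - c) * b = c * a - (1 - c) * b +
      (c * expR (- a) + (1 - c) * expR b - 1) by rewrite ab1 subrr addr0.
  by ring.
have fa : 0 <= expR (- a) - 1 + a by have := expR_ge1Dx (- a); lra.
have fb : b ^+ 2 / 4 <= expR b - 1 - b.
  have := expR_ge1Dx (b / 2) => h.
  have -> : expR b = expR (b / 2) ^+ 2 by rewrite -expRM_natl; congr expR; lra.
  have : 0 <= (expR (b / 2) - (1 + b / 2)) * (expR (b / 2) + (1 + b / 2)).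
    by rewrite mulr_ge0//; lra.
  by rewrite -subr_sqr; lra.
have nc : 0 <= n * c by rewrite mulr_ge0// ltW.
have nc' : 0 <= n * (1 - c) by rewrite mulr_ge0.
have h1 := mulr_ge0 nc fa.
have h2 := ler_wpM2l nc' fb.
have h3 : 0 <= n * (1 - c) * (b ^+ 2 / 4).
  by rewrite mulr_ge0// divr_ge0// sqr_ge0.
(* Here [8 * 4 <= 6 ^ 2], and for [a] below [8 * 6 <= 7 ^ 2]; the constant 13 is [6 + 7]. *)
have hb : n * x * b <= 6 * L.
  apply: (ler_mul_of_sqr_weighted _ _ _ _ (1 - c) _ 8 4) => //; lra.
suff ha : n * x * a <= 7 * L by rewrite mulrDr; lra.
(* The divergence is quadratic in [a] only for bounded [a]. Beyond 2 it is still at least linear,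
   and [x <= c] replaces the deviation bound. *)
have [a2|a2] := leP a 2.
  have ea := expRN_ge_cubic R a a0.
  have fa' : a ^+ 2 / 6 <= expR (- a) - 1 + a.
    have : 0 <= a ^+ 2 * (2 - a) by rewrite mulr_ge0 ?sqr_ge0//; lra.
    have -> : a ^+ 2 * (2 - a) = 2 * a ^+ 2 - a ^+ 3 by ring.
    lra.
  have h4 := ler_wpM2l nc fa'.
  apply: (ler_mul_of_sqr_weighted _ _ _ _ c _ 8 6) => //; lra.
have h4 : n * c * (a / 2) <= L.
  have fa' : a / 2 <= expR (- a) - 1 + a by have := expR_ge0 (- a); lra.
  have := ler_wpM2l nc fa'; lra.
have : n * x * a <= n * c * a by rewrite ler_wpM2r// ler_wpM2l.
lra.
Qed.

(** * Low-rank approximation on either side of a corner *)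

Lemma binomial_pmf_low_rank_above (R : realType) (n m : nat) (c L : R) :
  (0 < n)%N -> 0 < c < 1 -> 0 <= L -> (13 * expR 1 + 1) * L <= m%:R ->
  exists (alpha : 'I_m -> nat -> R) (beta : 'I_m -> R -> R),
  forall (j : nat) (q : R), (j <= n)%N -> 0 <= q <= c ->
    n%:R * c <= j%:R <= n%:R * (2 * c) ->
    `|binomial_pmf n q j - \sum_(i < m) alpha i j * beta i q| <= expR (- L).
Proof.
move=> n0 c01 L0 mL; have /andP[c0 c1] := c01.
have n0' : 0 < n%:R :> R by rewrite ltr0n.
have c1' : 0 < 1 - c by rewrite subr_gt0.
pose a q := - ln (q / c); pose b q := ln ((1 - q) / (1 - c)).
pose A j := binomial_pmf n c j.
pose B q := expR (- (n%:R * (c * a q - (1 - c) * b q))).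
pose alpha (i : 'I_m) j :=
  if expR (- L) <= A j then A j * (- (j%:R - n%:R * c)) ^+ i / i`!%:R else 0.
(* At [q = 0] the logarithm in [a] has a default value instead of minus infinity, so [B] is
   meaningless there; the test [0 < q] sets [beta] to 0. *)
pose beta (i : 'I_m) q :=
  if (0 < q) && (expR (- L) <= B q) then B q * (a q + b q) ^+ i else 0.
exists alpha, beta => j q jn /andP[q0 qc] /andP[cj jc].
have A0 : 0 <= A j by rewrite binomial_pmf_ge0// !ltW.
have A1 : A j <= 1 by rewrite binomial_pmf_le1// !ltW.
have q01 : 0 <= q <= 1 by rewrite q0 (le_trans qc)// ltW.
have P0 : 0 <= binomial_pmf n q j by rewrite binomial_pmf_ge0.
have trunc : (forall i, alpha i j * beta i q = 0) ->
    binomial_pmf n q j <= expR (- L) ->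
    `|binomial_pmf n q j - \sum_(i < m) alpha i j * beta i q| <= expR (- L).
  by move=> z h; rewrite big1 ?subr0 ?ger0_norm// => i _; exact: z.
have [q_gt0|q_le0] := ltP 0 q; last first.
  have q_eq0 : q = 0 by apply/eqP; rewrite eq_le q0 q_le0.
  apply: trunc => [i|]; first by rewrite /beta q_eq0 ltxx mulr0.
  have j0 : j != 0%N.
    apply/eqP => j0; move: cj; rewrite j0 leNgt => /negP; apply.
    by rewrite mulr_gt0.
  by rewrite /binomial_pmf q_eq0 expr0n (negbTE j0) mul0r mul0rn expR_ge0.
have q01' : 0 < q < 1 by rewrite q_gt0 (le_lt_trans qc).
have /andP[_ q1] := q01'.
have q1' : 0 < 1 - q by rewrite subr_gt0.
have a0 : 0 <= a q by rewrite oppr_ge0 ln_le0// ler_pdivrMr// mul1r.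
have b0 : 0 <= b q by rewrite ln_ge0// ler_pdivlMr// mul1r lerD2l lerN2.
have x0 : 0 <= j%:R - n%:R * c by rewrite subr_ge0.
have z0 : 0 <= (j%:R - n%:R * c) * (a q + b q) by rewrite mulr_ge0// addr_ge0.
have kl0 : c * expR (- a q) + (1 - c) * expR (b q) = 1.
  rewrite /a /b opprK !lnK ?posrE ?divr_gt0//.
  by field; rewrite !gt_eqF.
have B1 : B q <= 1.
  rewrite -[leRHS]expR0 ler_expR oppr_le0 mulr_ge0//.
  (* Nonnegativity of the divergence: [kl0] rewrites it as a weighted sum of gaps between [expR] and
     its tangent at 0. *)
  have -> : c * a q - (1 - c) * b q = c * (expR (- a q) - (1 - a q)) +
      (1 - c) * (expR (b q) - (1 + b q)).
    rewrite -[LHS]addr0 -[X in _ + X](subrr (c * expR (- a q) +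
      (1 - c) * expR (b q))) {2}kl0; ring.
  have := expR_ge1Dx (- a q); have := expR_ge1Dx (b q) => hb ha.
  by rewrite addr_ge0// mulr_ge0//; lra.
have PE : binomial_pmf n q j =
    A j * B q * expR (- ((j%:R - n%:R * c) * (a q + b q))).
  rewrite (binomial_pmf_tilt _ _ _ _ _ jn c01 q01') -mulrA -expRD.
  by congr (_ * expR _); rewrite /a /b; ring.
have E1 : expR (- ((j%:R - n%:R * c) * (a q + b q))) <= 1.
  by rewrite -[leRHS]expR0 ler_expR oppr_le0.
have AB0 : 0 <= A j * B q by rewrite mulr_ge0 ?expR_ge0.
have PAB : binomial_pmf n q j <= A j * B q by rewrite PE ler_piMr.
have [AL|AL] := leP (expR (- L)) (A j); last first.
  apply: trunc => [i|]; first by rewrite /alpha leNgt AL mul0r.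
  by apply: le_trans PAB (le_trans _ (ltW AL)); rewrite ler_piMr.
have [BL|BL] := leP (expR (- L)) (B q); last first.
  apply: trunc => [i|]; first by rewrite /beta (leNgt (expR _)) BL andbF mulr0.
  by apply: le_trans PAB (le_trans _ (ltW BL)); rewrite ler_piMl ?expR_ge0.
have -> : \sum_(i < m) alpha i j * beta i q = A j * B q *
    \sum_(i < m) (- ((j%:R - n%:R * c) * (a q + b q))) ^+ i / i`!%:R.
  rewrite mulr_sumr; apply: eq_bigr => i _.
  rewrite /alpha /beta AL q_gt0 BL /= -[- (_ * (_ + _))]mulNr exprMn; ring.
rewrite PE -mulrBr normrM ger0_norm//.
rewrite (@le_trans _ _ (1 * expR (- L)))// ?mul1r//.
have AB1 : A j * B q <= 1 by rewrite mulr_ile1// expR_ge0.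
have zL : (j%:R - n%:R * c) * (a q + b q) <= 13 * L.
  pose x := j%:R / n%:R - c.
  have jE : j%:R = n%:R * (c + x).
    by rewrite /x addrC subrK mulrC divfK ?gt_eqF.
  have xx : 0 <= x <= c.
    move: cj jc; rewrite jE !ler_pM2l//; lra.
  have [d1 d2] := binomial_pmf_ge_deviation _ _ _ _ _ _ jn n0 c01 xx jE AL.
  have -> : j%:R - n%:R * c = n%:R * x by rewrite jE; ring.
  apply: tilt_exponent_le kl0 d1 d2 _ => //.
  by move: BL; rewrite ler_expR lerN2.
rewrite -[leRHS]mul1r ler_pM//.
exact: expRN_taylor_small zL mL.
Qed.

(** Exchanging successes and failures maps [(c, q, j)] to [(1 - c, 1 - q, n - j)] and reduces this
    to the previous case. *)
Lemma binomial_pmf_low_rank_below (R : realType) (n m : nat) (c L : R) :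
  (0 < n)%N -> 0 < c < 1 -> 0 <= L -> (13 * expR 1 + 1) * L <= m%:R ->
  exists (alpha : 'I_m -> nat -> R) (beta : 'I_m -> R -> R),
  forall (j : nat) (q : R), (j <= n)%N -> c <= q <= 1 ->
    n%:R * (2 * c - 1) <= j%:R <= n%:R * c ->
    `|binomial_pmf n q j - \sum_(i < m) alpha i j * beta i q| <= expR (- L).
Proof.
move=> n0 /andP[c0 c1] L0 mL.
have c01' : 0 < 1 - c < 1 by lra.
have [alpha [beta h]] := binomial_pmf_low_rank_above _ _ _ _ _ n0 c01' L0 mL.
exists (fun i j => alpha i (n - j)%N), (fun i q => beta i (1 - q)).
move=> j q jn /andP[cq q1] /andP[cj jc].
rewrite -(binomial_pmf_onem _ _ _ _ jn); apply: h; first exact: leq_subr.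
  by lra.
by rewrite natrB//; lra.
Qed.

(** * Dyadic blocks and the choice of the rank *)

(** The corner is [k / 2^l] for odd [k] and [(k + 1) / 2^l] for even [k]. Its distance to 0,
    respectively 1, is at least the block width [1 / 2^l]. *)
Lemma block_low_rank (R : realType) (n l k m : nat) (L : R) :
  (0 < n)%N -> (1 <= l)%N -> (k < 2 ^ l)%N ->
  0 <= L -> (13 * expR 1 + 1) * L <= m%:R ->
  exists (alpha : 'I_m -> nat -> R) (beta : 'I_m -> R -> R),
  forall (j : nat) (q : R), (j <= n)%N -> 0 <= q <= 1 ->
    block R l k (j%:R / n%:R, q) ->
    `|binomial_pmf n q j - \sum_(i < m) alpha i j * beta i q| <= expR (- L).
Proof.
move=> n0 l1 kl L0 mL.
have n0' : 0 < n%:R :> R by rewrite ltr0n.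
have N0 : 0 < 2 ^+ l :> R by rewrite exprn_gt0.
have natN : (2 ^ l)%:R = 2 ^+ l :> R by rewrite natrX.
have [odd_k|even_k] := boolP (odd k).
  have k1 : 1 <= k%:R :> R by rewrite ler1n; case: k odd_k {kl}.
  have kN : k%:R < 2 ^+ l :> R by rewrite -natN ltr_nat.
  have c01 : 0 < (k%:R : R) / 2 ^+ l < 1.
    by rewrite divr_gt0 ?ltr_pdivrMr ?mul1r//=; lra.
  have [alpha [beta h]] := binomial_pmf_low_rank_above _ _ _ _ _ n0 c01 L0 mL.
  exists alpha, beta => j q jn /andP[q0 q1].
  rewrite /block odd_k => -[] /=; rewrite !in_itv /= => /andP[p1 p2] /andP[_ qc].
  apply: h => //; first by rewrite q0.
  rewrite ![n%:R * _]mulrC -ler_pdivlMr// p1 -ler_pdivrMr//=.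
  apply: le_trans p2 _; rewrite mulrA ler_pM2r ?invr_gt0//; lra.
(* By parity: [k + 1] is odd while [2 ^ l] is even, so [k + 1] cannot equal [2 ^ l]. *)
have kN : k%:R + 2 <= 2 ^+ l :> R.
  rewrite -natN -natrD ler_nat addn2 ltn_neqAle kl andbT.
  apply: contraNneq even_k => e; rewrite -[odd k]negbK -oddS e.
  by rewrite oddX orbF -lt0n l1.
have k0 : 0 <= k%:R :> R by [].
have c01 : 0 < ((k%:R : R) + 1) / 2 ^+ l < 1.
  by rewrite divr_gt0 ?ltr_pdivrMr ?mul1r//=; lra.
have [alpha [beta h]] := binomial_pmf_low_rank_below _ _ _ _ _ n0 c01 L0 mL.
exists alpha, beta => j q jn /andP[q0 q1].
rewrite /block (negbTE even_k) => -[] /=.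
rewrite !in_itv /= => /andP[p1 p2] /andP[qc _].
apply: h => //; first by rewrite qc.
rewrite ![n%:R * _]mulrC -ler_pdivrMr// p2 -ler_pdivlMr// andbT.
apply: le_trans p1; rewrite ler_pdivlMr// mulrBl mulrA divfK ?gt_eqF//; lra.
Qed.

Theorem mainTheorem5 (R : realType) :
  exists (S : R -> nat) (C : R),
    [/\ forall eps : R, 0 < eps -> (0 < S eps)%N,
        polylog_bounded S,
        0 < C &
        forall eps : R, 0 < eps ->
        forall n l k : nat, (1 <= n)%N -> (1 <= l)%N -> (k < 2 ^ l)%N ->
        exists (alpha beta : 'I_(S eps) -> R -> R),
        forall (j : nat) (p q : R),
          (j <= n)%N -> p = j%:R / n%:R -> 0 <= q <= 1 ->
          block R l k (p, q) ->
          `| binomial_pmf n q j - \sum_(i < S eps) alpha i p * beta i q |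
            <= C * eps].
Proof.
pose K : R := 13 * expR 1 + 1.
have K0 : 0 < K by have := expR_gt0 (1 : R); rewrite /K; lra.
pose S (eps : R) := (Num.truncn (K * ln (1 / eps))).+1.
have ln20 : 0 < ln 2 :> R by rewrite ln_gt0// ltr1n.
exists S, 2; split => //.
(* The summand [(ln 2)^-1] absorbs the successor in [S], because [ln (1 / eps) >= ln 2]. *)
- exists (K + (ln 2)^-1), 1; split => //; first by rewrite addr_gt0 ?invr_gt0.
  move=> eps /andP[eps0 eps2].
  have leps : ln 2 <= ln (1 / eps).
    rewrite ler_ln ?posrE ?divr_gt0// ler_pdivlMr//; lra.
  have L0 : 0 <= ln (1 / eps) by apply: le_trans leps; exact: ltW.
  rewrite powRr1// /S -natr1 [leRHS]mulrDl lerD//.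
    by rewrite truncn_le mulr_ge0// ltW.
  by rewrite ler_pdivlMl// mulr1.
- move=> eps eps0 n l k n1 l1 kl.
  (* For [eps > 1 / 2] the zero approximation has error at most [1 <= 2 * eps]; this is where the
     constant 2 comes from. *)
  have [eps2|eps2] := leP eps (1 / 2); last first.
    exists (fun _ _ => 0), (fun _ _ => 0) => j p q jn pE q01 _.
    rewrite big1 ?subr0 => [|i _]; last by rewrite mul0r.
    rewrite ger0_norm ?binomial_pmf_ge0//.
    by apply: le_trans (binomial_pmf_le1 _ _ _ _ q01) _; lra.
  have L0 : 0 <= ln (1 / eps) by rewrite ln_ge0// ler_pdivlMr//; lra.
  have mL : K * ln (1 / eps) <= (S eps)%:R by apply/ltW; exact: truncnS_gt.
  have [alpha [beta h]] := block_low_rank _ _ _ _ _ _ n1 l1 kl L0 mL.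
  (* Truncation recovers the integer [j] from [p = j / n]. *)
  exists (fun i p => alpha i (Num.truncn (p * n%:R))), beta => j p q jn pE q01 pq.
  have -> : p * n%:R = j%:R by rewrite pE divfK// pnatr_eq0 -lt0n.
  rewrite natrK; apply: le_trans (h j q jn q01 _) _; first by rewrite -pE.
  by rewrite div1r lnV ?posrE// opprK lnK ?posrE//; lra.
Qed.
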